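(* Let $g:\mathbb{R}^n\to\mathbb{R}^m$ be continuously differentiable. For every $x\le\widehat{x}$ in $\mathbb{R}^n$, let $\underline{J}_{[x,\widehat{x}]},\overline{J}_{[x,\widehat{x}]}\in\mathbb{R}^{m\times n}$ be matrices such that $Dg(z)\in[\underline{J}_{[x,\widehat{x}]},\overline{J}_{[x,\widehat{x}]}]$ for every $z\in[x,\widehat{x}]$. Then the function $\mathsf{G}^{\mathrm{jac}}:\mathcal{T}^{2n}_{\ge0}\to\mathcal{T}^{2m}_{\ge0}$ defined by $$\mathsf{G}^{\mathrm{jac}}(x,\widehat{x})=\begin{bmatrix}-[\underline{J}_{[x,\widehat{x}]}]^- & [\underline{J}_{[x,\widehat{x}]}]^-\\ -[\overline{J}_{[x,\widehat{x}]}]^+ & [\overline{J}_{[x,\widehat{x}]}]^+\end{bmatrix}\begin{bmatrix}x\\ \widehat{x}\end{bmatrix}+\begin{bmatrix}g(x)\\ g(x)\end{bmatrix}$$ is an inclusion function for $g$.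
   Context: Inequalities between vectors or matrices are entrywise. For $x\le\widehat{x}$, $[x,\widehat{x}]=\{z: x\le z\le\widehat{x}\}$, and similarly for matrices: $M\in[\underline{J},\overline{J}]$ means $\underline{J}\le M\le\overline{J}$ entrywise. $Dg(z)$ is the Jacobian of $g$ at $z$. For a matrix $B$, $[B]^+=\max(B,0)$ and $[B]^-=\min(B,0)$ entrywise, so $B=[B]^++[B]^-$. $\mathcal{T}^{2n}_{\ge0}=\{(x,\widehat{x})\in\mathbb{R}^{2n}: x\le\widehat{x}\}$. A function $\mathsf{G}=\begin{bmatrix}\underline{\mathsf{G}}\\ \overline{\mathsf{G}}\end{bmatrix}:\mathcal{T}^{2n}_{\ge0}\to\mathcal{T}^{2m}_{\ge0}$ is an inclusion function for $g$ if $\underline{\mathsf{G}}(x,\widehat{x})\le g(z)\le\overline{\mathsf{G}}(x,\widehat{x})$ for every $x\le\widehat{x}$ and every $z\in[x,\widehat{x}]$. *)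

(* Defs.v *)
From HB Require Import structures.
From mathcomp Require Import all_boot all_order all_algebra.
From mathcomp Require Import all_classical all_reals all_analysis.
Set Implicit Arguments.
Unset Strict Implicit.
Unset Printing Implicit Defensive.
Import Order.TTheory GRing.Theory Num.Theory numFieldNormedType.Exports.
Local Open Scope classical_set_scope.
Local Open Scope ring_scope.

Definition lemx (R : realType) (p q : nat) (A B : 'M[R]_(p, q)) : Prop :=
  forall i j, A i j <= B i j.

Notation "A <=e B" := (lemx A B) (at level 70, no associativity) : ring_scope.

Definition mxitv (R : realType) (p q : nat) (A B : 'M[R]_(p, q)) :
  set 'M[R]_(p, q) := [set M | A <=e M /\ M <=e B].

Definition mxpos (R : realType) (p q : nat) (B : 'M[R]_(p, q)) : 'M[R]_(p, q) :=
  map_mx (fun b => Num.max b 0) B.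

Definition mxneg (R : realType) (p q : nat) (B : 'M[R]_(p, q)) : 'M[R]_(p, q) :=
  map_mx (fun b => Num.min b 0) B.

(* The library's ['J] is for maps between row vectors and acts on the right, so
   it is the transpose of the usual m x n Jacobian matrix; see [DjacE]. *)
Definition Djac (R : realType) (n m : nat) (g : 'cV[R]_n -> 'cV[R]_m)
    (z : 'cV[R]_n) : 'M[R]_(m, n) :=
  ('J (fun u : 'rV[R]_n => (g u^T)^T) z^T)^T.

Definition continuously_differentiable (R : realType) (n m : nat)
    (g : 'cV[R]_n -> 'cV[R]_m) : Prop :=
  (forall z, differentiable g z) /\ continuous (Djac g).

(* A pair (x, xh) is encoded as the stacked column vector [col_mx x xh]. *)
Definition Tge0 (R : realType) (n : nat) : set 'cV[R]_(n + n) :=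
  [set w | usubmx w <=e dsubmx w].
Arguments Tge0 : clear implicits.

(* Only the values of [G] on [Tge0 R n] matter. *)
Definition inclusion_function (R : realType) (n m : nat)
    (g : 'cV[R]_n -> 'cV[R]_m) (G : 'cV[R]_(n + n) -> 'cV[R]_(m + m)) : Prop :=
  set_fun (Tge0 R n) (Tge0 R m) G /\
  forall x xh : 'cV[R]_n, x <=e xh -> forall z, mxitv x xh z ->
    usubmx (G (col_mx x xh)) <=e g z /\ g z <=e dsubmx (G (col_mx x xh)).

Definition Gjac (R : realType) (n m : nat) (g : 'cV[R]_n -> 'cV[R]_m)
    (Jl Ju : 'cV[R]_n -> 'cV[R]_n -> 'M[R]_(m, n)) (w : 'cV[R]_(n + n)) :
    'cV[R]_(m + m) :=
  let x := usubmx w in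
  let xh := dsubmx w in
  block_mx (- mxneg (Jl x xh)) (mxneg (Jl x xh))
           (- mxpos (Ju x xh)) (mxpos (Ju x xh)) *m col_mx x xh
  + col_mx (g x) (g x).

Lemma differentiable_trmx (R : realType) (p q : nat) (M : 'M[R]_(p, q)) :
  differentiable (trmx : 'M[R]_(p, q) -> 'M[R]_(q, p)) M.
Proof.
apply: linear_differentiable => N s /= /(nbhs_ballP (N^T)) [e e0 es].
apply/nbhs_ballP; exists e => //= N' [_ NN']; apply: es; split => // i j.
by rewrite !mxE; exact: NN'.
Qed.

Lemma DjacE (R : realType) (n m : nat) (g : 'cV[R]_n -> 'cV[R]_m)
    (z : 'cV[R]_n) : differentiable g z ->
  Djac g z = \matrix_(i, j) 'D_(delta_mx j 0) (fun y => g y i 0) z.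
Proof.
move=> dg.
pose tr p q : 'M[R]_(p, q) -> 'M[R]_(q, p) := trmx.
have dtr p q (M : 'M[R]_(p, q)) : differentiable (tr p q) M.
  exact: differentiable_trmx.
have trd p q (M : 'M[R]_(p, q)) : 'd (tr p q) M = tr p q :> (_ -> _).
  by apply: diff_lin => N; exact/differentiable_continuous/dtr.
have dg' : differentiable g (tr 1 n z^T) by rewrite /tr trmxK.
have dgt : differentiable (g \o tr 1 n) z^T by exact: differentiable_comp.
apply/matrixP => i j; rewrite !mxE.
have -> : (fun u : 'rV[R]_n => (g u^T)^T) = tr m 1 \o (g \o tr 1 n) by [].
rewrite diff_comp// diff_comp// !trd /= /tr trmxK mxE trmx_delta.
by rewrite -deriveE// derive_mx ?mxE//; exact: diff_derivable.
Qed.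

(* Main.v *)
(** Restricted to the segment from [x] to [z], the i-th component of [g] is a
    scalar function, so the mean value theorem gives
    [g_i(z) - g_i(x) = \sum_j Dg(c)_ij (z_j - x_j)] for some [c] in [[x, z]].
    Since [0 <= z_j - x_j <= xh_j - x_j], each summand lies between
    [min(Jl_ij, 0) (xh_j - x_j)] and [max(Ju_ij, 0) (xh_j - x_j)]. *)

Require Import Defs.
From HB Require Import structures.
From mathcomp Require Import all_boot all_order all_algebra.
From mathcomp Require Import all_classical all_reals all_analysis.
Set Implicit Arguments.
Unset Strict Implicit.
Unset Printing Implicit Defensive.
Import Order.TTheory GRing.Theory Num.Theory numFieldNormedType.Exports.
Local Open Scope classical_set_scope.
Local Open Scope ring_scope.

(** The point [c] comes from a scalar mean value theorem and so depends on the row [i]; one [c] need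
    not serve all rows. *)
Lemma mean_value_entry (R : realType) (n m : nat) (g : 'cV[R]_n -> 'cV[R]_m)
    (x z : 'cV[R]_n) (i : 'I_m) : (forall y, differentiable g y) ->
  exists2 c : R, c \in `[0, 1] &
    g z i 0 - g x i 0 = (Djac g (x + c *: (z - x)) *m (z - x)) i 0.
Proof.
move=> dg; set v := z - x.
pose f (y : 'cV[R]_n) : R := g y i 0.
pose l (t : R) : 'cV[R]_n := x + t *: v.
have df y : differentiable f y.
  exact: (differentiable_comp (dg y) (differentiable_coord _ _ _)).
have dl (t : R) : is_diff t l (fun s => s *: v).
  have -> : l = cst x + (fun s : R => s *: v) by [].
  apply: (is_diff_eq (is_diffD (is_diff_cst x t) (is_diff_scalel t v))).
  by rewrite add0r.
(* Chain rule along the segment, whose velocity is the constant [v]. *)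
have dphi (t : R) : is_derive t 1 (f \o l) ('d f (l t) v).
  have dlt : differentiable l t by exact: ex_diff.
  have dphit : differentiable (f \o l) t.
    exact: differentiable_comp.
  apply: DeriveDef; first exact: diff_derivable.
  rewrite deriveE// diff_comp//=.
  by rewrite diff_val scale1r.
have [|c c01] := MVT_segment ler01 (fun t _ => dphi t).
  apply: continuous_subspaceT => t.
  by apply/differentiable_continuous/derivable1_diffP; exact: ex_derive.
rewrite subr0 mulr1 /= /f /l scale1r scale0r addr0 subrKC => E.
exists c => //; rewrite E DjacE// mxE.
(* Expanding [v] in the standard basis turns the differential into a combination of partial
   derivatives, which are the entries of row [i] of [Djac]. *)
rewrite [X in 'd _ _ X]matrix_sum_delta linear_sum.
apply: eq_bigr => j _; rewrite big_ord1 linearZ/= mxE deriveE//.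
by rewrite mulrC.
Qed.

Lemma mxneg_le0 (R : realType) (p q : nat) (B : 'M[R]_(p, q)) i j :
  mxneg B i j <= 0.
Proof. by rewrite mxE ge_min lexx orbT. Qed.

Lemma mxpos_ge0 (R : realType) (p q : nat) (B : 'M[R]_(p, q)) i j :
  0 <= mxpos B i j.
Proof. by rewrite mxE le_max lexx orbT. Qed.

(** Each block row has the form [[-A, A]], so it only sees the width [xh - x], which is nonnegative
    on ordered pairs. *)
Lemma Gjac_col_mx (R : realType) (n m : nat) (g : 'cV[R]_n -> 'cV[R]_m)
    (Jl Ju : 'cV[R]_n -> 'cV[R]_n -> 'M[R]_(m, n)) (x xh : 'cV[R]_n) :
  Gjac g Jl Ju (col_mx x xh) =
  col_mx (mxneg (Jl x xh) *m (xh - x) + g x)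
         (mxpos (Ju x xh) *m (xh - x) + g x).
Proof.
rewrite /Gjac col_mxKu col_mxKd mul_block_col add_col_mx.
by rewrite !mulNmx !mulmxBr ![- _ + _ *m xh]addrC.
Qed.

Theorem proposition1 (R : realType) (n m : nat) (g : 'cV[R]_n -> 'cV[R]_m)
    (Jl Ju : 'cV[R]_n -> 'cV[R]_n -> 'M[R]_(m, n))
    (hg : continuously_differentiable g)
    (hJ : forall x xh : 'cV[R]_n, x <=e xh -> forall z, mxitv x xh z ->
      mxitv (Jl x xh) (Ju x xh) (Djac g z)) :
  inclusion_function g (Gjac g Jl Ju).
Proof.
case: hg => dg _; split.
  (* Values are ordered pairs: after [g x] cancels, [mxneg <= 0 <= mxpos] is multiplied by a
     nonnegative width. *)
  move=> w; rewrite -[w]vsubmxK /Tge0 /= !col_mxKu !col_mxKd.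
  move: (usubmx w) (dsubmx w) => x xh xxh.
  rewrite Gjac_col_mx col_mxKu col_mxKd => i k.
  rewrite [leLHS]mxE [leRHS]mxE lerD2r [leLHS]mxE [leRHS]mxE.
  apply: ler_sum => j _; apply: ler_wpM2r.
    by rewrite !mxE subr_ge0.
  exact: le_trans (mxneg_le0 _ _ _) (mxpos_ge0 _ _ _).
move=> x xh xxh z [xz zxh]; rewrite Gjac_col_mx col_mxKu col_mxKd.
suff H i : (mxneg (Jl x xh) *m (xh - x)) i 0 <= g z i 0 - g x i 0 <=
           (mxpos (Ju x xh) *m (xh - x)) i 0.
  split=> i k; have /andP[lo up] := H i; rewrite (ord1 k).
    by rewrite [leLHS]mxE -lerBrDr.
  by rewrite [leRHS]mxE -lerBlDr.
have [c] := mean_value_entry x z i dg.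
rewrite in_itv/= => /andP[c0 c1] ->.
have zx0 j : 0 <= (z - x) j 0 by rewrite !mxE subr_ge0.
have zxh' j : (z - x) j 0 <= (xh - x) j 0 by rewrite !mxE lerD2r.
(* The hypothesis on the Jacobian applies at this point: since [0 <= c <= 1], the step
   [c *: (z - x)] lies between [0] and [z - x <= xh - x]. *)
have segc : mxitv x xh (x + c *: (z - x)).
  have segE j : (x + c *: (z - x)) j 0 = x j 0 + c * (z - x) j 0.
    by rewrite !mxE.
  split=> j k; rewrite (ord1 k) segE; first by rewrite lerDl mulr_ge0.
  rewrite -lerBrDl (le_trans (ler_piMl (zx0 j) c1))//.
  by rewrite !mxE lerD2r.
have [Jlc cJu] := hJ _ _ xxh _ segc.
rewrite ![(_ *m _) i 0]mxE; apply/andP; split; apply: ler_sum => j _.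
  (* A nonpositive coefficient reverses [z - x <= xh - x]; then [mxneg Jl <= Jl <= Djac] is scaled
     by [z - x >= 0]. *)
  apply: (@le_trans _ _ (mxneg (Jl x xh) i j * (z - x) j 0)).
    exact: ler_wnM2l (mxneg_le0 _ _ _) _ _ (zxh' j).
  by apply: ler_wpM2r => //; rewrite mxE ge_min Jlc.
apply: (@le_trans _ _ (mxpos (Ju x xh) i j * (z - x) j 0)).
  by apply: ler_wpM2r => //; rewrite [leRHS]mxE le_max cJu.
exact: ler_wpM2l (mxpos_ge0 _ _ _) _ _ (zxh' j).
Qed.
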